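(* There is an absolute constant $c>0$ such that the following holds. For all positive integers $n$ and $w$ with $w\ge 2$ and for every deterministic distributed broadcast algorithm for a multiple-access channel with $n$ nodes, there exist a window adversary with individual injection rates, of window size $w$ and aggregate injection rate $1$, and an execution of the algorithm against this adversary, in which the packet latency is at least $c\,w\max(1,\log_w n)$ if $w\le n$, and at least $c\,w$ if $w>n$.
   Context: Channel. There are $n$ nodes with distinct names $1,\dots,n$; each node knows its name and $n$. Time is divided into synchronous rounds and all nodes start simultaneously. In each round each node performs, in this order: (1) it either transmits one message or pauses, as determined by its state; (2) it receives feedback from the channel; (3) packets may be injected into it; (4) it makes a deterministic state transition determined by its state at the end of the previous round, the packets injected into it in this round, and the feedback. A message may contain at most one packet (from the transmitting node's queue) and possibly control bits. If exactly one node transmits in a round, its message is heard by all nodes in this round; if no node transmits, the feedback is silence; if two or more nodes transmit, a collision occurs and nothing is heard. The channel is with collision detection if the feedback distinguishes silence from collision, and without collision detection otherwise; the claim concerns either kind of channel. Each node keeps its packets in a private queue of unbounded capacity; injected packets are enqueued in the round of injection, and a packet is discarded once it is heard. Packets are abstract markers whose contents do not affect the algorithm. The algorithm does not know any parameter of the adversary. Adversary. A window adversary with individual injection rates is given by a positive integer window size $w$ and non-negative integer shares $s_1,\dots,s_n$ with $\sum_{i=1}^n s_i\le w$; in any interval of $w$ contiguous rounds it may inject at most $s_i$ packets into node $i$, for each $i$. Its aggregate injection rate is $\rho=(\sum_{i=1}^n s_i)/w$. Latency. The delay of a packet is the number of rounds it spends waiting in a queue (infinite if it is never heard). Packet latency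 in an execution is the supremum of the delays of the packets; so ''latency at least $L$'' means that no bound smaller than $L$ holds for the delays of all packets. *)

(* Defs.v *)
From mathcomp Require Import all_boot all_order all_algebra.
From mathcomp Require Import all_classical all_reals all_analysis.

Set Implicit Arguments.
Unset Strict Implicit.
Unset Printing Implicit Defensive.

Import Order.TTheory GRing.Theory Num.Theory.

Local Open Scope ring_scope.

(* The packet (i, t, k) is the k-th packet injected into node i in round t.
   Nodes are numbered 0, ..., n-1 and rounds 0, 1, 2, ... *)
Definition packet (n : nat) := ('I_n * nat * nat)%type.

(* An optional packet, together with control bits. *)
Definition message (n : nat) := (option (packet n) * seq bool)%type.

(* [Heard b u] is the hearing of a message with control bits u; b tells whether
   it carried a packet.  Packets being abstract markers, nothing more about the
   packet is passed on to the algorithm. *)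
Inductive feedback := Silence | Collision | Heard of bool & seq bool.

(* The state of a node consists of a control state, of an arbitrary type, and of
   its queue.  Since packets are abstract markers, a node sees its queue only
   through the length q, and designates a packet by its position in arrival
   order, so that any queueing discipline is possible.
   - [transmit i s q] is [None] if node i pauses, and [Some (o, u)] if it
     transmits the control bits u and the packet at position o, if any.
   - [next i s q j f] is the new control state if j packets are injected and
     the feedback is f; q is the queue length at the end of the previous round. *)
Record algorithm (n : nat) := Algorithm {
  state : Type;
  init : 'I_n -> state;
  transmit : 'I_n -> state -> forall q : nat, option (option 'I_q * seq bool);
  next : 'I_n -> state -> nat -> nat -> feedback -> state }.

Section Execution.
Variables (cd : bool) (* is the channel with collision detection? *)
          (n : nat) (A : algorithm n).
Variable inj : nat -> 'I_n -> nat. (* number of packets injected, by round and node *)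

Definition configuration := 'I_n -> state A * seq (packet n).

Definition sent (C : configuration) (i : 'I_n) : option (message n) :=
  let: (s, q) := C i in
  omap (fun m => (omap (tnth (in_tuple q)) m.1, m.2)) (transmit i s (size q)).

Definition transmissions (C : configuration) : seq (message n) :=
  pmap (sent C) (enum 'I_n).

Definition heard_packet (C : configuration) : option (packet n) :=
  if transmissions C is [:: m] then m.1 else None.

Definition channel_feedback (C : configuration) : feedback :=
  match transmissions C with
  | [::] => Silence
  | [:: m] => Heard (isSome m.1) m.2
  | _ => if cd then Collision else Silence
  end.

Definition round (t : nat) (C : configuration) : configuration := fun i =>
  let: (s, q) := C i in
  let q' := if heard_packet C is Some p then rem p q else q in
  (next i s (size q) (inj t i) (channel_feedback C),
   q' ++ [seq (i, t, k) | k <- iota 0 (inj t i)]).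

(* [run t] is the configuration at the beginning of round t, so that [run t.+1]
   is the one at the end of round t. *)
Fixpoint run (t : nat) : configuration :=
  if t is t'.+1 then round t' (run t') else fun i => (init A i, [::]).

Definition injected : set (packet n) :=
  [set p | let: (i, t, k) := p in (k < inj t i)%N]%classic.

(* The number of rounds at the end of which p is queued: t' - t if p is injected
   in round t and heard in round t', and +oo if p is never heard. *)
Definition delay (R : realType) (p : packet n) : \bar R :=
  (\sum_(0 <= t <oo) ((p \in (run t.+1 p.1.1).2)%:R)%:E)%E.

Definition packet_latency (R : realType) : \bar R :=
  ereal_sup [set delay R p | p in injected]%classic.

End Execution.

Record window_adversary (n : nat) := WindowAdversary {
  window : nat;
  shares : 'I_n -> nat;
  window_gt0 : (0 < window)%N;
  shares_le_window : (\sum_(i < n) shares i <= window)%N }.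

Definition aggregate_rate (n : nat) (V : window_adversary n) : rat :=
  (\sum_(i < n) shares V i)%N%:R / (window V)%:R.

Definition admissible (n : nat) (V : window_adversary n)
    (inj : nat -> 'I_n -> nat) : Prop :=
  forall (i : 'I_n) (t0 : nat),
    (\sum_(t0 <= t < t0 + window V) inj t i <= shares V i)%N.

(* Main.v *)
(* Lower bound w: inject all w packets into one node at round 0; at most one of
   them is heard per round.

   Lower bound w log_w n (Greenberg and Winograd's conflict resolution argument,
   extended to nodes that transmit without having packets): the adversary keeps
   about w/2 disjoint blocks of nodes and commits only to injecting, at round 0,
   one packet into each of exactly two nodes of every block.  The blocks shrink so
   that the channel feedback never depends on which two nodes these are.  If in
   some large block a fraction 1/(4w) of the nodes would transmit when holding a
   packet, the block is restricted to these, which forces a collision.  Otherwise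
   all such nodes are withdrawn from the large blocks, and so are either two nodes
   that transmit when holding no packet, which then collide, or all of those; in
   the latter case the large blocks are silent.  In a single round the product of
   the block sizes, truncated from below at 8w, drops by a factor of at most 4w,
   and as long as a block is large none of its packets has been heard. *)
Require Import Defs.
From mathcomp Require Import all_boot all_order all_algebra.
From mathcomp Require Import all_classical all_reals all_analysis.
From mathcomp Require Import zify.
From mathcomp Require Import fintype finset.
Import Order.TTheory GRing.Theory Num.Theory.

Set Implicit Arguments.
Unset Strict Implicit.
Unset Printing Implicit Defensive.

(** * One round of the channel and its effect on the queues *)

Lemma eq_sent n (A : algorithm n) (C C' : configuration A) i :
  C i = C' i -> sent C i = sent C' i.
Proof. by rewrite /sent => ->. Qed.

Lemma heard_sent n (A : algorithm n) (C : configuration A) p :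
  heard_packet C = Some p -> exists2 i, p \in (C i).2 & sent C i.
Proof.
rewrite /heard_packet; case E: (transmissions C) => [|m [|//]] // mp.
have : m \in transmissions C by rewrite E mem_head.
rewrite mem_pmap => /mapP[i _ im]; exists i; last by rewrite -im.
move: im; rewrite /sent; case: (C i) => s q.
case: transmit => [[[k|] u]|] //= [em]; move: mp; rewrite em //= => -[<-].
exact: mem_tnth.
Qed.

Lemma collision cd n (A : algorithm n) (C : configuration A) x y :
  x != y -> sent C x -> sent C y ->
  channel_feedback cd C = (if cd then Collision else Silence) /\ heard_packet C = None.
Proof.
move=> xy Cx Cy; have : 1 < size (transmissions C).
  rewrite size_pmap -size_filter.
  rewrite (_ : size _ = #|[pred i | sent C i : bool]|); last first.
    by rewrite cardE /enum_mem -enumT filter_predT; congr size; apply: eq_filter.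
  by apply/card_gt1P; exists x, y.
by rewrite /channel_feedback /heard_packet; case: transmissions => [|? []].
Qed.

Lemma eq_sent_channel cd n (A : algorithm n) (C C' : configuration A) :
  sent C =1 sent C' ->
  channel_feedback cd C = channel_feedback cd C' /\ heard_packet C = heard_packet C'.
Proof.
move=> CC'; have e : transmissions C = transmissions C' by apply: eq_pmap.
by rewrite /channel_feedback /heard_packet e.
Qed.

Lemma round_queue cd n (A : algorithm n) inj t (C : configuration A) i :
  (round cd inj t C i).2 =
    (if heard_packet C is Some p then rem p (C i).2 else (C i).2)
    ++ [seq (i, t, k) | k <- iota 0 (inj t i)].
Proof. by rewrite /round; case: (C i). Qed.

Lemma runS cd n (A : algorithm n) inj t :
  run cd A inj t.+1 = Defs.round cd inj t (run cd A inj t).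
Proof. by []. Qed.

Lemma run_owner cd n (A : algorithm n) inj t i p :
  p \in (run cd A inj t i).2 -> p.1.1 = i.
Proof.
elim: t i => [|t IHt] i //; rewrite runS round_queue mem_cat.
case/orP=> [|/mapP[k _ ->] //].
by case: heard_packet => [p'|] => [/mem_rem|]; apply: IHt.
Qed.

(** * Injection in round 0 only, and latency bounds from packets still queued *)

Definition one_shot n (f : 'I_n -> nat) (t : nat) (i : 'I_n) : nat :=
  if t is 0 then f i else 0.

Lemma one_shot_admissible n (V : window_adversary n) f :
  (forall i, f i <= shares V i) -> admissible V (one_shot f).
Proof.
move=> fV i t0; rewrite -[X in _ <= X]addn0.
case: t0 => [|t0]; last first.
  by rewrite big_nat big1 // => -[].
rewrite add0n big_ltn ?window_gt0 // big_nat big1 => [|[]//].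
by rewrite leq_add2r fV.
Qed.

Lemma mem_run_one_shot cd n (A : algorithm n) f i p t t' : t <= t' ->
  p \in (run cd A (one_shot f) t'.+1 i).2 -> p \in (run cd A (one_shot f) t.+1 i).2.
Proof.
move=> /subnKC <-; elim: (t' - t) => [|d IHd]; first by rewrite addn0.
rewrite addnS [run _ _ _ _]/= round_queue cats0 => pr; apply: IHd.
by move: pr; case: heard_packet => // p'; apply: mem_rem.
Qed.

(** Nothing is injected after round 0, so a packet queued at time [T] has been queued since the end
    of round 0, and the first [T] terms of the series [delay] equal 1. *)
Lemma latency_ge cd n (A : algorithm n) (R : realType) f p T : 0 < T ->
  p \in (run cd A (one_shot f) T p.1.1).2 ->
  (T%:R%:E <= packet_latency cd A (one_shot f) R)%E.
Proof.
case: p T => [[i t0] k0] [//|T] /= _ pT; set p := (i, t0, k0) in pT *.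
have pt t : t <= T -> p \in (run cd A (one_shot f) t.+1 i).2.
  by move=> /mem_run_one_shot; apply.
apply: (@le_trans _ _ (delay cd A (one_shot f) R p)); last first.
  apply: ereal_sup_ubound; exists p => //.
  move: (pt 0 isT); rewrite runS round_queue mem_cat => /orP[].
    by case: heard_packet.
  by case/mapP=> k; rewrite mem_iota add0n /= => kf [-> ->].
rewrite /delay (nneseries_split 0 T.+1); last by move=> k _; rewrite lee_fin.
rewrite add0n -[leLHS]adde0; apply: leeD; last first.
  by apply: nneseries_ge0 => k _ _; rewrite lee_fin.
rewrite big_nat (eq_bigr (fun _ => 1%:E)); last first.
  by move=> t /andP[_]; rewrite ltnS => /pt ->.
by rewrite -big_nat sumEFin lee_fin sumr_const_nat subn0.
Qed.

(** Each round takes at most one packet off the queue, so one of the [w] packets is left after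
    [w.-1] further rounds. *)
Lemma latency_ge_one_node cd n (A : algorithm n) (R : realType) (i0 : 'I_n) w : 0 < w ->
  (w%:R%:E <= packet_latency cd A (one_shot (fun i => if i == i0 then w else 0%N)) R)%E.
Proof.
set f := fun i => _; move=> w_gt0.
have sz t : w <= size (run cd A (one_shot f) t.+1 i0).2 + t.
  elim: t => [|t IHt].
    by rewrite runS round_queue size_cat size_map size_iota /= /f eqxx addn0 leq_addl.
  rewrite runS round_queue cats0; apply: leq_trans IHt _.
  rewrite addnS -addSn leq_add2r; case: heard_packet => // p.
  have [/size_rem ->|/rem_id ->//] := boolP (p \in (run cd A (one_shot f) t.+1 i0).2).
  exact: leqSpred.
have := sz w.-1; case E: (run cd A (one_shot f) w.-1.+1 i0).2 => [|p q].
  by rewrite /= add0n -ltnS prednK // ltnn.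
move=> _; rewrite prednK // in E.
have pq : p \in (run cd A (one_shot f) w i0).2 by rewrite E mem_head.
by apply: (@latency_ge _ _ _ _ _ p); rewrite // (run_owner pq).
Qed.

(** * Disjoint blocks and the injection sets they still allow *)

Definition disjoint_blocks n m (B : 'I_m -> {set 'I_n}) : Prop :=
  forall j k i, i \in B j -> i \in B k -> j = k.

Lemma disjoint_blocks_sub n m (B B' : 'I_m -> {set 'I_n}) :
  disjoint_blocks B -> (forall j, B' j \subset B j) -> disjoint_blocks B'.
Proof.
move=> disB sB j k i ij ik; apply: (disB j k i).
  exact: (subsetP (sB j)).
exact: (subsetP (sB k)).
Qed.

(** The sets of receiving nodes to which the adversary can still commit. *)
Definition chosen n m (B : 'I_m -> {set 'I_n}) (S : {set 'I_n}) : Prop :=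
  S \subset \bigcup_j B j /\ forall j, #|S :&: B j| = 2.

Lemma chosen_sub n m (B B' : 'I_m -> {set 'I_n}) S :
  disjoint_blocks B -> (forall j, B' j \subset B j) -> chosen B' S -> chosen B S.
Proof.
move=> disB sB [SB' cS]; split.
  apply: subset_trans SB' _; apply/bigcupsP => j _.
  by apply: subset_trans (sB j) _; apply: bigcup_sup.
move=> j; rewrite -(cS j); congr #|pred_of_set _|; apply/setP => i; rewrite !inE.
have [iS /=|//] := boolP (i \in S); apply/idP/idP => [iB|]; last exact: (subsetP (sB j)).
have /bigcupP[k _ ik] := subsetP SB' _ iS.
by rewrite (disB j k i iB) //; apply: (subsetP (sB k)).
Qed.

Lemma chosen_exists n m (B : 'I_m -> {set 'I_n}) :
  disjoint_blocks B -> (forall j, 1 < #|B j|) -> exists S, chosen B S.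
Proof.
move=> disB B2.
have /choice[P PB] (j : 'I_m) : exists P : {set 'I_n}, P \subset B j /\ #|P| = 2.
  have /card_gt1P[x [y [xB yB xy]]] := B2 j; exists [set x; y]; split.
    by apply/subsetP => z /set2P[] ->.
  by rewrite cards2 xy.
exists (\bigcup_j P j); split.
  by apply/bigcupsP => j _; apply: subset_trans (PB j).1 _; apply: bigcup_sup.
move=> j; rewrite -(PB j).2; congr #|pred_of_set _|; apply/setP => i; rewrite inE.
apply/andP/idP => [[/bigcupP[k _ ik] ij]|ij].
  by rewrite (disB j k i) // (subsetP (PB k).1).
by rewrite (subsetP (PB j).1) //; split=> //; apply/bigcupP; exists j.
Qed.

Lemma card_chosen n m (B : 'I_m -> {set 'I_n}) S : chosen B S -> #|S| <= m.*2.
Proof.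
case=> SB cS; have -> : m.*2 = \sum_(j < m) #|S :&: B j|.
  by rewrite (eq_bigr (fun _ => 2)) // sum_nat_const card_ord muln2.
have -> : S = \bigcup_j (S :&: B j).
  by rewrite -big_distrr /=; apply/esym/setIidPl.
rewrite [X in _ <= X](eq_bigr (fun j => #|S :&: B j|)); last first.
  by move=> j _; rewrite -big_distrr /= (setIidPl SB).
elim/big_ind2: _ => [|a A b A' aA bA'|//]; first by rewrite cards0.
by rewrite cardsU (leq_trans (leq_subr _ _)) // leq_add.
Qed.

(** * Shrinking the blocks in one round *)

(* Bernoulli's inequality (1 - 1/a)^m >= 1 - m/a, multiplied by a^(m+1). *)
Lemma expn_predn_bound a m : m <= a -> a ^ m * (a - m) <= a * a.-1 ^ m.
Proof.
elim: m => [|m IHm] ma; first by rewrite !expn0 subn0 mul1n muln1.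
have := IHm (ltnW ma); rewrite !expnS => {}IHm.
rewrite [X in _ <= X](_ : _ = a.-1 * (a * a.-1 ^ m)); last by rewrite mulnCA.
apply: leq_trans (leq_mul (leqnn _) IHm).
rewrite -mulnA mulnCA [X in _ <= X]mulnCA leq_mul2l; apply/orP; right.
by nia.
Qed.

(** A small block cut down to two nodes lies inside every chosen set, so its behaviour is fully
    determined; the truncated sizes do not notice the cut. *)
Lemma collapse_blocks n m (B : 'I_m -> {set 'I_n}) L :
  1 < L -> (forall j, 1 < #|B j|) ->
  exists B' : 'I_m -> {set 'I_n}, [/\ forall j, B' j \subset B j,
    forall j, #|B' j| = 2 \/ L <= #|B' j| &
    forall j, maxn #|B' j| L = maxn #|B j| L].
Proof.
move=> L2 B2; suff /choice[B' B'P] (j : 'I_m) : exists P : {set 'I_n},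
    [/\ P \subset B j, #|P| = 2 \/ L <= #|P| & maxn #|P| L = maxn #|B j| L].
  by exists B'; split=> j; case: (B'P j).
have [LB|BL] := leqP L #|B j|.
  by exists (B j); split=> //; [right | rewrite (maxn_idPl LB)].
have /card_gt1P[x [y [xB yB xy]]] := B2 j; exists [set x; y]; split.
- by apply/subsetP => z /set2P[] ->.
- by left; rewrite cards2 xy.
- by rewrite cards2 xy (maxn_idPr L2).
Qed.

(** Here [sends i b] tells whether node [i] transmits, [b] being its membership in the chosen set.
    Either alternative makes the feedback independent of that set: a certain collision, or silence
    of all blocks not contained in it. *)
Lemma refine_blocks n m (B : 'I_m -> {set 'I_n}) w (sends : 'I_n -> bool -> bool) :
  m <= w -> 0 < w -> disjoint_blocks B -> (forall j, 1 < #|B j|) ->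
  exists B' : 'I_m -> {set 'I_n}, [/\ forall j, B' j \subset B j,
    forall j, 1 < #|B' j|,
    \prod_j maxn #|B j| (8 * w) <= 4 * w * \prod_j maxn #|B' j| (8 * w) &
    (forall S, chosen B' S ->
       exists x y, [/\ x != y, sends x (x \in S) & sends y (y \in S)]) \/
    (forall j, #|B' j| = 2 \/ forall i b, i \in B' j -> ~~ sends i b)].
Proof.
move=> mw w0 disB B2; set L := 8 * w.
have L2 : 1 < L by rewrite /L; lia.
have [B1 [sB1 B1L B1B]] := collapse_blocks L2 B2.
have sep1 : disjoint_blocks B1.
  exact: disjoint_blocks_sub disB sB1.
have B12 j : 1 < #|B1 j| by case: (B1L j) => [->//|]; apply: leq_trans.
rewrite -(eq_bigr _ (fun j _ => B1B j)) => {B1B}.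
suff [B' [sB' B'2 B'W B'S]] : exists B' : 'I_m -> {set 'I_n},
    [/\ forall j, B' j \subset B1 j, forall j, 1 < #|B' j|,
    \prod_j maxn #|B1 j| L <= 4 * w * \prod_j maxn #|B' j| L &
    (forall S, chosen B' S ->
       exists x y, [/\ x != y, sends x (x \in S) & sends y (y \in S)]) \/
    (forall j, #|B' j| = 2 \/ forall i b, i \in B' j -> ~~ sends i b)].
  by exists B'; split=> // j; apply: subset_trans (sB' j) (sB1 j).
move=> {sB1}; move: B1 B1L sep1 B12 => {B disB B2} B BL disB B2.
set Q1 := [set i | sends i true].
have [/existsP[j /andP[Lj Qj]]|noj] :=
    boolP [exists j, (L <= #|B j|) && (#|B j| <= 4 * w * #|Q1 :&: B j|)].
  exists (fun k => if k == j then Q1 :&: B j else B k); split.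
  - by move=> k; case: eqP => [->|//]; apply: subsetIr.
  (* The threshold [L] is twice [4 * w], so the restricted block keeps two nodes. *)
  - move=> k; case: eqP => [_|//]; have := leq_trans Lj Qj.
    rewrite (_ : L = 4 * w * 2); last by rewrite /L; lia.
    by rewrite leq_pmul2l ?muln_gt0 //.
  - rewrite (bigD1 j) //= [X in _ <= _ * X](bigD1 j) //= eqxx mulnA.
    apply: leq_mul; last by apply: leq_prod => k /negPf ->.
    by rewrite (maxn_idPl Lj) (leq_trans Qj) // leq_mul2l leq_maxl orbT.
  - left=> S [_ /(_ j)]; rewrite eqxx => cS.
    have /card_gt1P[x [y [xS yS xy]]] : 1 < #|S :&: (Q1 :&: B j)| by rewrite cS.
    exists x, y; move: xS yS; rewrite !inE => /and3P[-> ? _] /and3P[-> ? _].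
    by split.
(* Z collects two nodes whose empty-handed transmissions collide, or else all
   the nodes of large blocks that transmit empty-handed. *)
pose Q0 := [set i | sends i false] :&: \bigcup_(j | L <= #|B j|) B j.
have [Z [ZQ Zle Zcase]] : exists Z : {set 'I_n},
    [/\ Z \subset Q0, #|Z| <= 2 & 1 < #|Z| \/ Z = Q0].
  have [/card_gt1P[x [y [xQ yQ xy]]]|Q1le] := ltnP 1 #|Q0|.
    exists [set x; y]; rewrite cards2 xy; split=> //; last by left.
    by apply/subsetP => z /set2P[] ->.
  by exists Q0; split=> //; [apply: leq_trans Q1le _ | right].
pose B' j := if L <= #|B j| then B j :\: (Q1 :|: Z) else B j.
(* A large block loses less than a fraction 1/(4w) to [Q1], and at most 2 nodes to [Z], again at
   most 1/(4w) of its size as this is at least 8w. *)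
have B'card j : L <= #|B j| -> (2 * w).-1 * #|B j| <= 2 * w * #|B' j|.
  move=> Lj; move: noj => /existsPn/(_ j); rewrite Lj /= -ltnNge => Qj.
  rewrite /B' Lj cardsD.
  have : #|B j :&: (Q1 :|: Z)| <= #|Q1 :&: B j| + 2.
    rewrite setIUr setIC cardsU (leq_trans (leq_subr _ _)) // leq_add2l.
    by apply: leq_trans Zle; apply: subset_leq_card; apply: subsetIr.
  by rewrite /L in Lj; move: Lj Qj; move: #|_| #|_| #|_| => b q c; nia.
have B'sub j : B' j \subset B j by rewrite /B'; case: ifP => // _; apply: subsetDl.
exists B'; split=> //.
- move=> j; have [Lj|/negPf Lj] := boolP (L <= #|B j|); last by rewrite /B' Lj.
  have := B'card j Lj; rewrite /L in Lj; move: #|B' j| #|B j| Lj => b' b; nia.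
- have W : \prod_j ((2 * w).-1 * maxn #|B j| L) <= \prod_j (2 * w * maxn #|B' j| L).
    apply: leq_prod => j _; have [Lj|/negPf Lj] := boolP (L <= #|B j|).
      by rewrite (maxn_idPl Lj) (leq_trans (B'card j Lj)) // leq_mul2l leq_maxl orbT.
    by rewrite /B' Lj leq_mul2r leq_pred orbT.
  move: W; rewrite [X in X <= _]big_split [X in _ <= X]big_split /=.
  rewrite !prod_nat_const card_ord => W.
  (* Since m <= w, Bernoulli gives (1 - 1/(2w))^m >= 1/2: the product loses at most a factor 2,
     within the allowed 4w. *)
  have E : (2 * w) ^ m * w <= 2 * w * (2 * w).-1 ^ m.
    apply: leq_trans (@expn_predn_bound (2 * w) m _); last by lia.
    by rewrite leq_mul2l; apply/orP; right; lia.
  have d_gt0 : 0 < (2 * w) ^ m * w by rewrite muln_gt0 expn_gt0; lia.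
  rewrite -(leq_pmul2l d_gt0); apply: leq_trans (leq_mul E (leqnn _)) _.
  rewrite -mulnA; apply: leq_trans (leq_mul (leqnn _) W) _.
  rewrite [X in _ <= X](_ : _ = 2 * w * ((2 * w) ^ m * \prod_j maxn #|B' j| L) * (2 * w)).
    apply: leq_pmulr; lia.
  by move: (\prod_j _) (_ ^ m) => a d; lia.
case: Zcase => [/card_gt1P[x [y [xZ yZ xy]]]|ZQ0].
  (* By disjointness a node of [Z] lies in no other block, so its withdrawal keeps it out of [S]. *)
  left=> S [SB' _]; exists x, y.
  suff H z : z \in Z -> sends z (z \in S) by split=> //; apply: H.
  move=> zZ; have := subsetP ZQ _ zZ; rewrite !inE => /andP[z0 /bigcupP[j Lj zj]].
  suff /negPf -> : z \notin S by [].
  apply/negP => /(subsetP SB')/bigcupP[k _ zk].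
  have jk : j = k by apply: (disB j k z zj); apply: (subsetP (B'sub k)).
  by move: zk; rewrite -jk /B' Lj !inE zZ orbT.
right=> j; case: (BL j) => [Bj2|Lj].
  by left; rewrite /B' Bj2 leqNgt (_ : 2 < L) ?Bj2 // /L; lia.
right=> i b; rewrite /B' Lj ZQ0 !inE negb_or negb_and -andbA => /and3P[i1 + ij].
have -> : i \in \bigcup_(k | L <= #|B k|) B k by apply/bigcupP; exists j.
by rewrite orbF; case: b.
Qed.

(** * Delaying the choice of the injection set round by round *)

Definition one_each n (S : {set 'I_n}) : nat -> 'I_n -> nat :=
  one_shot (fun i => nat_of_bool (i \in S)).

(* The configuration of node i depends on the chosen set S only through whether
   i is in S: this is how the adversary may decide on S after the fact. *)
Definition indistinguishable cd n (A : algorithm n) m t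
    (B : 'I_m -> {set 'I_n}) : Prop :=
  exists C : 'I_n -> bool -> state A * seq (packet n),
    forall S, chosen B S -> forall i, run cd A (one_each S) t i = C i (i \in S).

Definition pending cd n (A : algorithm n) m t L (B : 'I_m -> {set 'I_n}) : Prop :=
  forall S j i, chosen B S -> L <= #|B j| -> i \in S -> i \in B j ->
    (i, 0, 0) \in (run cd A (one_each S) t i).2.

(** Without a forced collision, nodes outside the blocks are never chosen, two-node blocks always
    are, and the others are silent. So all chosen sets give the same transmissions, and a heard
    packet, belonging to its transmitter, is from no large block. *)
Lemma round_constant cd n (A : algorithm n) m t (B B' : 'I_m -> {set 'I_n}) L :
  2 < L -> disjoint_blocks B -> (forall j, B' j \subset B j) -> (forall j, 1 < #|B' j|) ->
  forall C : 'I_n -> bool -> state A * seq (packet n),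
  (forall S, chosen B S -> forall i, run cd A (one_each S) t i = C i (i \in S)) ->
  let sends i b := isSome (sent (fun x => C x b) i) in
  (forall S, chosen B' S ->
     exists x y, [/\ x != y, sends x (x \in S) & sends y (y \in S)]) \/
  (forall j, #|B' j| = 2 \/ forall i b, i \in B' j -> ~~ sends i b) ->
  exists fb hp,
    [/\ forall S, chosen B' S -> channel_feedback cd (run cd A (one_each S) t) = fb,
        forall S, chosen B' S -> heard_packet (run cd A (one_each S) t) = hp &
        forall j i, L <= #|B' j| -> i \in B' j -> hp <> Some (i, 0, 0)].
Proof.
move=> L2 disB sB B'2 C runC sends.
have sep' : disjoint_blocks B'.
  exact: disjoint_blocks_sub disB sB.
have sentE S i : chosen B' S ->
    sent (run cd A (one_each S) t) i = sent (fun x => C x (i \in S)) i.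
  by move=> /(chosen_sub disB sB) cS; apply: eq_sent; rewrite runC.
case=> [coll|silent].
  exists (if cd then Collision else Silence), None; split=> // S cS;
    have [x [y [xy Cx Cy]]] := coll S cS;
    by have [] := @collision cd n A (run cd A (one_each S) t) x y xy;
      rewrite ?sentE.
have [S0 cS0] := chosen_exists sep' B'2.
have same S : chosen B' S ->
    sent (run cd A (one_each S) t) =1 sent (run cd A (one_each S0) t).
  move=> cS i; rewrite !sentE //.
  have [/bigcupP[j _ ij]|iB'] := boolP (i \in \bigcup_j B' j); last first.
    have notS S' : chosen B' S' -> (i \in S') = false.
      by case=> SB' _; apply/negP => /(subsetP SB'); apply/negP.
    by rewrite !notS.
  have [B'j|sil] := silent j.
    have inS S' : chosen B' S' -> (i \in S') = true.
      case=> _ /(_ j) S'j; have /eqP S'B : S' :&: B' j == B' j.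
        by rewrite eqEcard subsetIr S'j B'j.
      by move: ij; rewrite -S'B inE => /andP[].
    by rewrite !inS.
  have None_sent b : sent (fun x => C x b) i = None.
    by have := sil i b ij; rewrite /sends; case: sent.
  by rewrite !None_sent.
exists (channel_feedback cd (run cd A (one_each S0) t)),
  (heard_packet (run cd A (one_each S0) t)); split.
- by move=> S /same /(eq_sent_channel cd)[].
- by move=> S /same /(eq_sent_channel cd)[].
move=> j i Lj ij /heard_sent[k /run_owner <-]; rewrite sentE //=.
by have [B'j|/(_ i (i \in S0) ij) /negP//] := silent j; rewrite B'j leqNgt L2 in Lj.
Qed.

Lemma adversary_step cd n (A : algorithm n) m t w (B : 'I_m -> {set 'I_n}) :
  m <= w -> 0 < w -> disjoint_blocks B -> (forall j, 1 < #|B j|) ->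
  indistinguishable cd A t.+1 B -> pending cd A t.+1 (8 * w) B ->
  exists B' : 'I_m -> {set 'I_n},
    [/\ disjoint_blocks B', forall j, 1 < #|B' j|,
      indistinguishable cd A t.+2 B' /\ pending cd A t.+2 (8 * w) B' &
      \prod_j maxn #|B j| (8 * w) <= 4 * w * \prod_j maxn #|B' j| (8 * w)].
Proof.
move=> mw w0 disB B2 [C runC] pend.
have [B' [sB B'2 B'W cases]] :=
  refine_blocks (fun i b => isSome (sent (fun x => C x b) i)) mw w0 disB B2.
have L2 : 2 < 8 * w by lia.
have [fb [hp [Efb Ehp hpN]]] := round_constant L2 disB sB B'2 runC cases.
exists B'; split=> //.
  exact: disjoint_blocks_sub disB sB.
split.
  (* After round 0 there are no injections, and the feedback is [fb] for every chosen set. *)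
  exists (fun i b => let: (s, q) := C i b in
    (Defs.next i s (size q) 0 fb, (if hp is Some p then rem p q else q) ++ [::])).
  move=> S cS i; rewrite runS /Defs.round (runC S) ?Efb ?Ehp //.
  exact: chosen_sub cS.
move=> S j i cS Lj iS ij; rewrite runS round_queue cats0 Ehp //.
have iq : (i, 0, 0) \in (run cd A (one_each S) t.+1 i).2.
  apply: (pend S j) => //; last exact: (subsetP (sB j)).
    exact: chosen_sub cS.
  exact: leq_trans Lj (subset_leq_card (sB j)).
have := hpN j i Lj ij; case: (hp) => [p pi|//].
rewrite -has_pred1 has_count count_mem_rem.
by case: eqP => [pe|_]; [case: pi; rewrite pe | rewrite subn0 -has_count has_pred1].
Qed.

Lemma adversary_steps cd n (A : algorithm n) m w T (B : 'I_m -> {set 'I_n}) :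
  m <= w -> 0 < w -> disjoint_blocks B -> (forall j, 1 < #|B j|) ->
  exists B' : 'I_m -> {set 'I_n},
    [/\ disjoint_blocks B', forall j, 1 < #|B' j|,
      pending cd A T.+1 (8 * w) B' &
      \prod_j maxn #|B j| (8 * w) <= (4 * w) ^ T * \prod_j maxn #|B' j| (8 * w)].
Proof.
move=> mw w0 disB B2.
suff [B' [? ? [_ ?] ?]] : exists B' : 'I_m -> {set 'I_n},
    [/\ disjoint_blocks B', forall j, 1 < #|B' j|,
      indistinguishable cd A T.+1 B' /\ pending cd A T.+1 (8 * w) B' &
      \prod_j maxn #|B j| (8 * w) <= (4 * w) ^ T * \prod_j maxn #|B' j| (8 * w)].
  by exists B'; split.
elim: T => [|T [B' [dis' B'2 [ind' pend'] W']]].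
  (* In round 0 transmissions precede injections, so the feedback cannot depend on [S] and no block
     has to shrink. *)
  exists B; split=> //; last by rewrite mul1n.
  split.
    exists (fun i b => (Defs.next i (init A i) 0 b
        (channel_feedback cd (fun i => (init A i, [::]) : state A * seq (packet n))),
      (if heard_packet (fun i => (init A i, [::]) : state A * seq (packet n)) is Some p
       then rem p [::] else [::]) ++ [seq (i, 0, k) | k <- iota 0 b])).
    by [].
  move=> S j i cS _ iS _; rewrite runS round_queue mem_cat.
  by apply/orP; right; apply/mapP; exists 0 => //=; rewrite iS.
have [B'' [dis'' B''2 ip W'']] := adversary_step mw w0 dis' B'2 ind' pend'.
exists B''; split=> //; apply: leq_trans W' _.
by rewrite expnSr -mulnA leq_mul2l W'' orbT.
Qed.

(** * From the block sizes to the latency bound *)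

Lemma initial_blocks n m N : m * N <= n ->
  exists B : 'I_m -> {set 'I_n}, disjoint_blocks B /\ forall j, N <= #|B j|.
Proof.
move=> mNn; exists (fun j : 'I_m => [set i : 'I_n | i %/ N == j]); split.
  by move=> j k i; rewrite !inE => /eqP ij /eqP ik; apply: val_inj; rewrite /= -ij -ik.
move=> j.
have lt_n (k : 'I_N) : j * N + k < n.
  apply: leq_trans mNn; apply: (@leq_trans (j.+1 * N)).
    by rewrite mulSn addnC ltn_add2r.
  by rewrite leq_mul2r ltn_ord orbT.
have inj_lt : injective (fun k : 'I_N => Ordinal (lt_n k)).
  by move=> k l /(congr1 val)/= /addnI /val_inj.
rewrite -[X in X <= _](card_ord N) -cardsT -(card_imset _ inj_lt).
apply: subset_leq_card; apply/subsetP => _ /imsetP[k _ ->]; rewrite inE /=.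
have N0 : 0 < N := leq_ltn_trans (leq0n k) (ltn_ord k).
by rewrite divnMDl // divn_small // addn0.
Qed.

(** Were all blocks small after [T] shrinking rounds, their truncated product would be
    [(8 * w) ^ m], too little for a start of at least [N ^ m]. So a large block survives, with its
    packets pending. *)
Lemma latency_ge_blocks cd n (A : algorithm n) (R : realType) m w N T :
  m <= w -> 0 < w -> m * N <= n -> (8 * w) ^ m * (4 * w) ^ T < N ^ m ->
  exists S : {set 'I_n}, #|S| <= m.*2 /\
    (T.+1%:R%:E <= packet_latency cd A (one_each S) R)%E.
Proof.
move=> mw w0 mNn WT.
have LN : 8 * w < N.
  rewrite ltnNge; apply: contraL WT => NL; rewrite -leqNgt.
  apply: (@leq_trans ((8 * w) ^ m)); first by case: (m) => [//|m']; rewrite leq_exp2r.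
  by apply: leq_pmulr; rewrite expn_gt0 muln_gt0 w0.
have [B [disB BN]] := initial_blocks mNn.
have B2 j : 1 < #|B j| by apply: leq_trans (BN j); lia.
have [B' [dis' B'2 pend W]] := adversary_steps cd A T mw w0 disB B2.
have [j Lj] : exists j, 8 * w <= #|B' j|.
  apply/existsP; apply: contraLR WT => /existsPn noj; rewrite -leqNgt.
  apply: (@leq_trans (\prod_j maxn #|B j| (8 * w))).
    rewrite -[X in N ^ X](card_ord m) -prod_nat_const; apply: leq_prod => j _.
    by rewrite (leq_trans (BN j)) // leq_maxl.
  apply: leq_trans W _; rewrite mulnC leq_mul2r; apply/orP; right.
  rewrite -[X in _ <= _ ^ X](card_ord m) -prod_nat_const; apply: leq_prod => j _.
  by rewrite geq_max leqnn andbT ltnW // ltnNge noj.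
have [S cS] := chosen_exists dis' B'2; exists S; split; first exact: card_chosen cS.
have /card_gt0P[i] : 0 < #|S :&: B' j| by rewrite cS.2.
rewrite inE => /andP[iS ij].
by apply: (@latency_ge _ _ _ _ _ (i, 0, 0)) => //; apply: (pend S j).
Qed.

(** * Choice of parameters and the lower bound *)

Lemma rate1_adversary n (f : 'I_n -> nat) w : 0 < w -> \sum_i f i = w ->
  exists V : window_adversary n,
    [/\ window V = w, shares V = f & aggregate_rate V = 1%R].
Proof.
move=> w0 fw; have fw' : \sum_i f i <= w by rewrite fw.
exists (WindowAdversary w0 fw'); split=> //.
by rewrite /aggregate_rate /= fw divff // pnatr_eq0 -lt0n.
Qed.

Lemma ln_ratio_trunc_log (R : realType) n w : 0 < n -> 1 < w ->
  (ln n%:R / ln w%:R <= (trunc_log w n).+1%:R :> R)%R.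
Proof.
move=> n0 w1; have lnw : (0 < ln w%:R :> R)%R by rewrite ln_gt0 // ltr1n.
rewrite ler_pdivrMr // mulr_natl -lnXn ?ltr0n; last exact: ltnW.
rewrite -natrX ler_ln ?posrE ?ltr0n ?expn_gt0 ?(ltnW w1) //.
by rewrite ler_nat ltnW // trunc_log_ltn.
Qed.

Lemma block_parameters w n : 1 < w -> 0 < n -> 10 < trunc_log w n ->
  exists m N T, [/\ m.*2 <= w, m * N <= n, (8 * w) ^ m * (4 * w) ^ T < N ^ m &
    w * (trunc_log w n).+1 <= 18 * T.+1].
Proof.
move=> w1 n0; set q := trunc_log w n => q10.
have m0 : 0 < w./2 by lia.
(* Two packets per block fit into the window, and [m * N] is at most [w ^ q]. As 8w <= w^4 and 4w <=
   w^3, it suffices that 4m + 3T < (q - 1)m, which dictates [T]. *)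
exists w./2, (w ^ q.-1), (((q - 5) * w./2).-1 %/ 3).
set m := w./2 in m0 *; set T := _ %/ 3.
have T3 : T * 3 < (q - 5) * m.
  by apply: leq_ltn_trans (leq_trunc_div _ _) _; rewrite ltn_predL muln_gt0 m0 andbT; lia.
have mw : m <= w by rewrite /m; lia.
split.
- by rewrite /m; lia.
- have := trunc_logP w1 n0; rewrite -/q -(@prednK q) ?expnS; last by lia.
  by apply: leq_trans; rewrite leq_mul2r mw orbT.
- have w8 : 8 * w <= w ^ 4 by rewrite expnSr leq_mul2r (@leq_exp2r 2 w 3) ?w1 ?orbT.
  have w4 : 4 * w <= w ^ 3 by rewrite expnSr leq_mul2r (@leq_exp2r 2 w 2) ?w1 ?orbT.
  apply: (@leq_ltn_trans ((w ^ 4) ^ m * (w ^ 3) ^ T)).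
    have leq_exp a b k : a <= b -> a ^ k <= b ^ k.
      by move=> ab; case: k => // k; rewrite leq_exp2r.
    by apply: leq_mul; apply: leq_exp.
  by rewrite -!expnM -expnD ltn_exp2l //; nia.
have : (q - 5) * m <= 3 * T.+1.
  have := ltn_ceil ((q - 5) * m).-1 (isT : 0 < 3); rewrite -/T mulnC; lia.
(* For q >= 11, q + 1 <= 2(q - 5), so w(q + 1) <= 6m(q - 5) <= 18(T + 1): hence the constant 18. *)
have : w <= 3 * m by rewrite /m; lia.
by clear T3; clearbody T m q => wm qT; nia.
Qed.

Local Open Scope ring_scope.

Theorem theorem3 (R : realType) :
  exists c : R, 0 < c /\
    forall (cd : bool) (n w : nat), (0 < n)%N -> (2 <= w)%N ->
    forall A : algorithm n,
    exists V : window_adversary n,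
      window V = w /\ aggregate_rate V = 1 /\
      exists inj : nat -> 'I_n -> nat,
        admissible V inj /\
        ((w <= n)%N ->
           ((c * w%:R * Num.max 1 (ln n%:R / ln w%:R))%:E
              <= packet_latency cd A inj R)%E) /\
        ((n < w)%N ->
           ((c * w%:R)%:E <= packet_latency cd A inj R)%E).
Proof.
exists 18%:R^-1; split=> [|cd n w n0 w1 A]; first by rewrite invr_gt0 ltr0n.
have i0 : 'I_n := Ordinal n0; have w0 : (0 < w)%N := ltnW w1.
(* The shares [g] may exceed the actual injections [f]; they are padded to sum to [w], making the
   rate exactly 1. *)
suff [f [L [fw wL qL latL]]] : exists (f : 'I_n -> nat) (L : nat),
    [/\ exists2 g : 'I_n -> nat, (forall i, f i <= g i)%N & (\sum_i g i = w)%N,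
        (w <= 18 * L)%N, (w * (trunc_log w n).+1 <= 18 * L)%N &
        (L%:R%:E <= packet_latency cd A (one_shot f) R)%E].
  have [g fg gw] := fw; have [V [Vw Vg V1]] := rate1_adversary w0 gw.
  exists V; do 2 split=> //; exists (one_shot f); split.
    by apply: one_shot_admissible; rewrite Vg.
  have scale (x : R) : w%:R * x <= (18 * L)%:R ->
      ((18%:R^-1 * w%:R * x)%:E <= packet_latency cd A (one_shot f) R)%E.
    move=> xL; apply: le_trans latL.
    by rewrite lee_fin -mulrA mulrC ler_pdivrMr ?ltr0n // -natrM mulnC.
  split=> _; last by rewrite -[_ * _]mulr1 scale // mulr1 ler_nat.
  apply: scale; rewrite maxr_pMr ?ler0n // ge_max mulr1 ler_nat wL /=.
  apply: le_trans (ler_wpM2l (ler0n _ _) (ln_ratio_trunc_log R n0 w1)) _.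
  by rewrite -natrM ler_nat.
(* For a logarithm of at most 10, loading one node suffices, as 11w <= 18w. *)
have [q10|q10] := leqP (trunc_log w n) 10.
  exists (fun i => if i == i0 then w else 0%N), w; split.
  - exists (fun i => if i == i0 then w else 0%N) => //.
    by rewrite -big_mkcond big_pred1_eq.
  - by rewrite leq_pmull.
  - by rewrite mulnC leq_mul2r; apply/orP; right; lia.
  - exact: latency_ge_one_node.
have [m [N [T [mw mNn WT wqT]]]] := block_parameters w1 n0 q10.
have mw' : (m <= w)%N by lia.
have [S [cardS latS]] := latency_ge_blocks cd A R mw' w0 mNn WT.
have Sw := leq_trans cardS mw.
exists (fun i => nat_of_bool (i \in S)), T.+1; split=> //; last by nia.
exists (fun i => (i \in S) + if i == i0 then w - #|S| else 0)%N => [i|].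
  exact: leq_addr.
by rewrite big_split /= -!big_mkcond sum1_card big_pred1_eq subnKC.
Qed.
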